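(* Let $c>0$, let $a,b>0$ with $a\neq b$, and let $\Omega=(-a,b)$ be decomposed into $\Omega_1=(-a,0)$ and $\Omega_2=(0,b)$. Let $\theta=\frac14$. If $k\ge1$ is an integer and the time window length $T>0$ satisfies $$\frac{T}{k}\le 4\min\left\{\frac ac,\frac bc\right\},$$ then the NNWR algorithm on $\Omega\times(0,T)$ (defined in the context) converges in at most $k+1$ iterations.
   Context: Model problem in one space dimension with wave speed $c>0$: $\partial_{tt}u-c^2\partial_{xx}u=f(x,t)$ for $x\in\Omega=(-a,b)$, $0<t<T$; $u(x,0)=u_0(x)$, $u_t(x,0)=v_0(x)$ for $x\in\Omega$; $u(x,t)=g(x,t)$ for $x\in\{-a,b\}$, $0<t<T$. The domain is split into $\Omega_1=(-a,0)$ and $\Omega_2=(0,b)$, with interface $\Gamma=\{0\}$. The unit outward normal derivatives at the interface are $\partial_{n_1}=\partial_x$ (for $\Omega_1$) and $\partial_{n_2}=-\partial_x$ (for $\Omega_2$). The data and initial guesses are assumed regular and compatible enough that all problems below are uniquely solvable and the interface traces and derivatives are well defined. Neumann-Neumann Waveform Relaxation (NNWR) with relaxation parameter $\theta\in(0,1]$: given an initial guess $w^0(t)$, $t\in(0,T)$, for iterations $j=1,2,\ldots$ compute, for $i=1,2$, $u_i^j$ on $\Omega_i\times(0,T)$ from $\partial_{tt}u_i^j-c^2\partial_{xx}u_i^j=f$, $u_i^j(x,0)=u_0(x)$, $\partial_tu_i^j(x,0)=v_0(x)$, $u_i^j=g$ on $\partial\Omega_i\setminus\Gamma$, $u_i^j(0,t)=w^{j-1}(t)$;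 then, for $i=1,2$, $\psi_i^j$ on $\Omega_i\times(0,T)$ from $\partial_{tt}\psi_i^j-c^2\partial_{xx}\psi_i^j=0$, $\psi_i^j(x,0)=0$, $\partial_t\psi_i^j(x,0)=0$, $\psi_i^j=0$ on $\partial\Omega_i\setminus\Gamma$, $\partial_{n_i}\psi_i^j=\partial_{n_1}u_1^j+\partial_{n_2}u_2^j$ on $\Gamma$; then update $w^j(t)=w^{j-1}(t)-\theta\,[\psi_1^j(0,t)+\psi_2^j(0,t)]$. The algorithm converges in at most $m$ iterations if, for every initial guess $w^0$, $u_i^m$ equals the exact solution $u$ on $\Omega_i\times(0,T)$ for $i=1,2$. *)

(* Defs.v *)
From Stdlib Require Import Reals.
From Coquelicot Require Import Coquelicot.
Open Scope R_scope.

(** Functions of space and time are total, written [u x t]; only their values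
    on the relevant (closed) space-time rectangle matter. *)

(** Derivative relative to a set [S]; for an interval this is the one-sided
    derivative at an endpoint and the usual derivative at an interior point. *)
Definition is_derive_within (S : R -> Prop) (f : R -> R) (x l : R) : Prop :=
  filterlim (fun y => (f y - f x) / (y - x)) (within S (locally' x)) (locally l).

Definition ex_derive_within (S : R -> Prop) (f : R -> R) (x : R) : Prop :=
  exists l, is_derive_within S f x l.

(** [iota P] is the unique real satisfying [P] (meaningful only when the
    derivative exists). *)
Definition Derive_within (S : R -> Prop) (f : R -> R) (x : R) : R :=
  iota (T := R_CompleteSpace) (is_derive_within S f x).

Definition space (l r : R) (x : R) : Prop := l <= x <= r.
Definition time (T : R) (t : R) : Prop := 0 <= t < T.
Definition cylinder (l r T : R) (p : R * R) : Prop :=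
  space l r (fst p) /\ time T (snd p).

Definition dx (l r : R) (u : R -> R -> R) (x t : R) : R :=
  Derive_within (space l r) (fun y => u y t) x.
Definition dt (T : R) (u : R -> R -> R) (x t : R) : R :=
  Derive_within (time T) (fun s => u x s) t.

(** Regularity of classical solutions on [(l,r) x (0,T)]: C^2 in the open
    rectangle and C^1 up to the lateral boundary and the initial time. *)
Record regular (l r T : R) (u : R -> R -> R) : Prop := {
  regular_C2 : forall x t, l < x < r -> 0 < t < T -> ex_diff_n u 2 x t;
  regular_ex_dx : forall x t, space l r x -> time T t ->
    ex_derive_within (space l r) (fun y => u y t) x;
  regular_ex_dt : forall x t, space l r x -> time T t ->
    ex_derive_within (time T) (fun s => u x s) t;
  regular_cont : continuous_on (cylinder l r T) (fun p => u (fst p) (snd p));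
  regular_cont_dx :
    continuous_on (cylinder l r T) (fun p => dx l r u (fst p) (snd p));
  regular_cont_dt :
    continuous_on (cylinder l r T) (fun p => dt T u (fst p) (snd p))
}.

(** Classical solution of [u_tt - c^2 u_xx = f] on [(l,r) x (0,T)] with initial
    displacement [u0] and velocity [v0]; no lateral condition yet. *)
Record wave_ivp (c l r T : R) (f : R -> R -> R) (u0 v0 : R -> R)
    (u : R -> R -> R) : Prop := {
  wave_regular : regular l r T u;
  wave_pde : forall x t, l < x < r -> 0 < t < T ->
    Derive_n (fun s => u x s) 2 t - c ^ 2 * Derive_n (fun y => u y t) 2 x = f x t;
  wave_init_value : forall x, l < x < r -> u x 0 = u0 x;
  wave_init_velocity : forall x, l < x < r -> dt T u x 0 = v0 x
}.

Record model_solution (c a b T : R) (f g : R -> R -> R) (u0 v0 : R -> R)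
    (u : R -> R -> R) : Prop := {
  model_wave : wave_ivp c (- a) b T f u0 v0 u;
  model_left : forall t, 0 < t < T -> u (- a) t = g (- a) t;
  model_right : forall t, 0 < t < T -> u b t = g b t
}.

(** Outward normal derivatives at the interface [x = 0], taken from
    [(-a,0)] and from [(0,b)]. *)
Definition dn1 (a : R) (v : R -> R -> R) (t : R) : R := dx (- a) 0 v 0 t.
Definition dn2 (b : R) (v : R -> R -> R) (t : R) : R := - dx 0 b v 0 t.

(** One iteration, from the interface guess [w] to the updated guess [w']. *)
Record NNWR_step (c a b T theta : R) (f g : R -> R -> R) (u0 v0 : R -> R)
    (w : R -> R) (u1 u2 psi1 psi2 : R -> R -> R) (w' : R -> R) : Prop := {
  dirichlet1_wave : wave_ivp c (- a) 0 T f u0 v0 u1;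
  dirichlet1_outer : forall t, 0 < t < T -> u1 (- a) t = g (- a) t;
  dirichlet1_interface : forall t, 0 < t < T -> u1 0 t = w t;
  dirichlet2_wave : wave_ivp c 0 b T f u0 v0 u2;
  dirichlet2_outer : forall t, 0 < t < T -> u2 b t = g b t;
  dirichlet2_interface : forall t, 0 < t < T -> u2 0 t = w t;
  neumann1_wave :
    wave_ivp c (- a) 0 T (fun _ _ => 0) (fun _ => 0) (fun _ => 0) psi1;
  neumann1_outer : forall t, 0 < t < T -> psi1 (- a) t = 0;
  neumann1_interface : forall t, 0 < t < T ->
    dn1 a psi1 t = dn1 a u1 t + dn2 b u2 t;
  neumann2_wave :
    wave_ivp c 0 b T (fun _ _ => 0) (fun _ => 0) (fun _ => 0) psi2;
  neumann2_outer : forall t, 0 < t < T -> psi2 b t = 0;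
  neumann2_interface : forall t, 0 < t < T ->
    dn2 b psi2 t = dn1 a u1 t + dn2 b u2 t;
  interface_update : forall t, 0 < t < T ->
    w' t = w t - theta * (psi1 0 t + psi2 0 t)
}.

(** A run started from the guess [w 0]; the entries of [u1, u2, psi1, psi2] at
    index 0 are unused. *)
Definition NNWR_run (c a b T theta : R) (f g : R -> R -> R) (u0 v0 : R -> R)
    (w : nat -> R -> R) (u1 u2 psi1 psi2 : nat -> R -> R -> R) : Prop :=
  forall j : nat,
    NNWR_step c a b T theta f g u0 v0 (w j)
      (u1 (S j)) (u2 (S j)) (psi1 (S j)) (psi2 (S j)) (w (S j)).

(** Since [w 0] is arbitrary in a run, this quantifies over all initial guesses
    for which the successive problems have classical solutions. *)
Definition NNWR_converges_in_at_most (c a b T theta : R) (f g : R -> R -> R)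
    (u0 v0 : R -> R) (m : nat) : Prop :=
  forall u : R -> R -> R, model_solution c a b T f g u0 v0 u ->
  forall (w : nat -> R -> R) (u1 u2 psi1 psi2 : nat -> R -> R -> R),
    NNWR_run c a b T theta f g u0 v0 w u1 u2 psi1 psi2 ->
    (forall x t, - a < x < 0 -> 0 < t < T -> u1 m x t = u x t) /\
    (forall x t, 0 < x < b -> 0 < t < T -> u2 m x t = u x t).

(* Main.v *)
(** On each subdomain the error [e = u_i - u] solves the homogeneous wave
    equation with zero initial data, so [e_t - c e_x] and [e_t + c e_x] are
    constant along characteristics, and the outer Dirichlet condition reflects
    one into minus the other.  Hence all interface traces are combinations of a
    single function and its delay by the round trip time [2a/c] or [2b/c].
    Write [h] for the time derivative of the error at the interface.  With
    [theta = 1/4], an iteration cancels [h] up to terms delayed twice, so if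
    [h] vanishes before time [s], the next one vanishes before
    [s + 4 min(a/c, b/c)].  After [k] iterations [h = 0] on [(0, T)], and the
    subdomain errors of iteration [k + 1] vanish. *)

Require Import Defs.
From Stdlib Require Import Reals Lra Lia.
From Coquelicot Require Import Coquelicot.
Open Scope R_scope.

(** * Derivatives and continuity relative to a set *)

(** Since [l < r], every punctured neighbourhood of [x] meets the segment on at least one side.
    Properness of this filter makes relative derivatives unique, so that [iota] picks the right
    value. *)
Lemma within_locally'_proper (S : R -> Prop) (l r x : R) :
  l < r -> l <= x <= r -> (forall y, l <= y <= r -> S y) ->
  ProperFilter' (within S (locally' x)).
Proof.
intros Hlr Hx HS; split.
- intros [d Hd].
  assert (Hd0 := cond_pos d).
  destruct (Rlt_dec x r) as [H|H].
  + set (y := Rmin r (x + d / 2)).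
    assert (x < y /\ y <= r /\ y <= x + d / 2) as [H1 [H2 H3]].
    { unfold y; repeat split; [apply Rmin_glb_lt; lra | apply Rmin_l | apply Rmin_r]. }
    apply (Hd y); [|lra|apply HS; lra].
    change (Rabs (y - x) < d); rewrite Rabs_pos_eq; lra.
  + set (y := Rmax l (x - d / 2)).
    assert (y < x /\ l <= y /\ x - d / 2 <= y) as [H1 [H2 H3]].
    { unfold y; repeat split; [apply Rmax_lub_lt; lra | apply Rmax_l | apply Rmax_r]. }
    apply (Hd y); [|lra|apply HS; lra].
    change (Rabs (y - x) < d); rewrite Rabs_left; lra.
- apply within_filter, locally'_filter.
Qed.

Lemma Derive_within_eq (S : R -> Prop) (f : R -> R) (x l : R) :
  ProperFilter' (within S (locally' x)) ->
  is_derive_within S f x l -> Derive_within S f x = l.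
Proof.
intros HF Hl; unfold Derive_within.
exact (@iota_filterlim_locally R_AbsRing R_CompleteNormedModule R _ HF _ _ Hl).
Qed.

Lemma Derive_within_correct (S : R -> Prop) (f : R -> R) (x : R) :
  ProperFilter' (within S (locally' x)) ->
  ex_derive_within S f x -> is_derive_within S f x (Derive_within S f x).
Proof.
intros HF [l Hl]; now rewrite (Derive_within_eq S f x l).
Qed.

Lemma is_derive_within_subset (S S' : R -> Prop) (f : R -> R) (x l : R) :
  (forall y, S' y -> S y) -> is_derive_within S f x l -> is_derive_within S' f x l.
Proof.
intros HS Hf P HP.
generalize (Hf P HP); unfold filtermap, within.
apply filter_imp; auto.
Qed.

Lemma is_derive_of_is_derive_within (S : R -> Prop) (f : R -> R) (x l : R) :
  locally x S -> is_derive_within S f x l -> is_derive f x l.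
Proof.
intros HS Hf; apply is_derive_Reals; intros eps Heps.
assert (H := proj1 (filterlim_locally _ _) Hf (mkposreal eps Heps)).
destruct (filter_and _ _ HS H) as [d Hd].
exists d; intros h Hh Hhd.
destruct (Hd (x + h)) as [H1 H2].
{ change (Rabs (x + h - x) < d); now replace (x + h - x) with h by ring. }
assert (Hne : x + h <> x) by lra.
generalize (H2 Hne H1); change (Rabs ((f (x + h) - f x) / (x + h - x) - l) < eps ->
  Rabs ((f (x + h) - f x) / h - l) < eps).
now replace (x + h - x) with h by ring.
Qed.

Lemma is_derive_within_minus (S : R -> Prop) (f g : R -> R) (x l m : R) :
  is_derive_within S f x l -> is_derive_within S g x m ->
  is_derive_within S (fun y => f y - g y) x (l - m).
Proof.
intros Hf Hg.
assert (Filter (within S (locally' x))) by apply within_filter, locally'_filter.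
apply filterlim_ext with (fun y => minus ((f y - f x) / (y - x)) ((g y - g x) / (y - x))).
{ intros y; unfold minus, plus, opp; simpl; unfold Rdiv; ring. }
unfold minus.
eapply filterlim_comp_2; [exact Hf| |exact (filterlim_plus l (- m))].
eapply filterlim_comp; [exact Hg|exact (filterlim_opp m)].
Qed.

Lemma space_proper (l r x : R) :
  l < r -> space l r x -> ProperFilter' (within (space l r) (locally' x)).
Proof. intros; apply within_locally'_proper with l r; auto. Qed.

Lemma time_proper (T t : R) : time T t -> ProperFilter' (within (time T) (locally' t)).
Proof.
intros [H1 H2]; apply within_locally'_proper with t ((t + T) / 2); try lra.
intros y Hy; split; lra.
Qed.

Lemma locally_open_interval (l r x : R) : l < x < r -> locally x (fun y => l < y < r).
Proof.
intros Hx; apply (open_and _ _ (open_gt l) (open_lt r)); exact Hx.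
Qed.

Lemma locally_space (l r x : R) : l < x < r -> locally x (space l r).
Proof.
intros Hx; generalize (locally_open_interval l r x Hx).
apply filter_imp; unfold space; intros; lra.
Qed.

Lemma locally_time (T t : R) : 0 < t < T -> locally t (time T).
Proof.
intros Ht; generalize (locally_open_interval 0 T t Ht).
apply filter_imp; unfold time; intros; lra.
Qed.

Lemma locally_2d_open_rectangle (l r m s x y : R) :
  l < x < r -> m < y < s -> locally_2d (fun u v => l < u < r /\ m < v < s) x y.
Proof.
intros Hx Hy.
destruct (locally_open_interval l r x Hx) as [d Hd].
destruct (locally_open_interval m s y Hy) as [e He].
exists (mkposreal _ (Rmin_pos _ _ (cond_pos d) (cond_pos e))); simpl.
intros u v Hu Hv; split.
- apply Hd; apply Rlt_le_trans with (1 := Hu), Rmin_l.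
- apply He; apply Rlt_le_trans with (1 := Hv), Rmin_r.
Qed.

Lemma continuous_on_comp {U V W : UniformSpace} (D : U -> Prop) (E : V -> Prop)
  (f : U -> V) (g : V -> W) :
  (forall x, D x -> E (f x)) -> continuous_on D f -> continuous_on E g ->
  continuous_on D (fun x => g (f x)).
Proof.
intros HDE Hf Hg x Hx.
eapply filterlim_comp; [|exact (Hg (f x) (HDE x Hx))].
intros P HP; unfold filtermap, within in *.
generalize (Hf x Hx _ HP); unfold filtermap, within.
apply filter_imp; intros y Hy Dy; auto.
Qed.

Lemma continuous_on_minus {U : UniformSpace} (D : U -> Prop) (f g : U -> R) :
  continuous_on D f -> continuous_on D g -> continuous_on D (fun x => f x - g x).
Proof.
intros Hf Hg x Hx.
assert (Filter (within D (locally x))) by apply within_filter, locally_filter.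
change (filterlim (fun x => plus (f x) (opp (g x))) (within D (locally x))
  (locally (plus (f x) (opp (g x))))).
eapply filterlim_comp_2; [exact (Hf x Hx)| |exact (filterlim_plus (f x) (- g x))].
eapply filterlim_comp; [exact (Hg x Hx)|exact (filterlim_opp (g x))].
Qed.

Lemma continuous_on_scal {U : UniformSpace} (D : U -> Prop) (k : R) (f : U -> R) :
  continuous_on D f -> continuous_on D (fun x => k * f x).
Proof.
intros Hf x Hx; eapply filterlim_comp; [exact (Hf x Hx)|].
exact (filterlim_scal_r (K := R_AbsRing) (V := R_NormedModule) k (f x)).
Qed.

(* Clamping the argument to [[a, b]] turns continuity relative to the segment
   into two-sided continuity, as the mean value theorem requires. *)
Lemma is_derive_0_segment_const (f : R -> R) (a b : R) :
  a <= b -> continuous_on (fun x => a <= x <= b) f ->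
  (forall x, a < x < b -> is_derive f x 0) -> f b = f a.
Proof.
intros Hab Hc Hd.
set (p := fun x => Rmax a (Rmin x b)).
assert (Hp : forall x, a <= p x <= b).
{ intros x; unfold p; split; [apply Rmax_l|].
  apply Rmax_lub; [lra|apply Rmin_r]. }
assert (Hpid : forall x, a <= x <= b -> p x = x).
{ intros x Hx; unfold p; rewrite Rmin_left, Rmax_right; lra. }
assert (Hpc : forall x, continuous p x).
{ intros x; apply filterlim_locally; intros eps; exists eps; intros y Hy.
  change (Rabs (y - x) < eps) in Hy; change (Rabs (p y - p x) < eps).
  apply Rle_lt_trans with (2 := Hy).
  unfold p, Rmax, Rmin, Rabs; repeat destruct Rle_dec; repeat destruct Rcase_abs; lra. }
destruct (MVT_gen (fun x => f (p x)) a b (fun _ => 0)) as [x [_ Hx]].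
- intros x; rewrite Rmin_left, Rmax_right by lra; intros Hx.
  apply is_derive_ext_loc with f; [|now apply Hd].
  generalize (locally_open_interval a b x Hx); apply filter_imp.
  intros y Hy; rewrite Hpid; lra.
- intros x _; apply continuity_pt_filterlim.
  apply (continuous_continuous_on (fun _ => True) (fun x => f (p x)) x); [now apply filter_forall|].
  apply (continuous_on_comp (fun _ => True) (fun x => a <= x <= b) p f); auto.
  apply continuous_on_forall; auto.
- rewrite !Hpid in Hx by lra; lra.
Qed.

(** * Regular functions: one-sided derivatives, differences, restrictions *)

Lemma regular_dx (l r T : R) (u : R -> R -> R) (x t : R) :
  regular l r T u -> l < r -> space l r x -> time T t ->
  is_derive_within (space l r) (fun y => u y t) x (dx l r u x t).
Proof.
intros Hu Hlr Hx Ht; apply Derive_within_correct.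
- now apply space_proper.
- exact (regular_ex_dx _ _ _ _ Hu x t Hx Ht).
Qed.

Lemma regular_dt (l r T : R) (u : R -> R -> R) (x t : R) :
  regular l r T u -> space l r x -> time T t ->
  is_derive_within (time T) (fun s => u x s) t (dt T u x t).
Proof.
intros Hu Hx Ht; apply Derive_within_correct.
- now apply time_proper.
- exact (regular_ex_dt _ _ _ _ Hu x t Hx Ht).
Qed.

Lemma is_derive_dx (l r T : R) (u : R -> R -> R) (x t : R) :
  regular l r T u -> l < x < r -> time T t -> is_derive (fun y => u y t) x (dx l r u x t).
Proof.
intros Hu Hx Ht; apply is_derive_of_is_derive_within with (space l r).
- now apply locally_space.
- apply regular_dx with T; unfold space; auto; lra.
Qed.

Lemma is_derive_dt (l r T : R) (u : R -> R -> R) (x t : R) :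
  regular l r T u -> space l r x -> 0 < t < T -> is_derive (fun s => u x s) t (dt T u x t).
Proof.
intros Hu Hx Ht; apply is_derive_of_is_derive_within with (time T).
- now apply locally_time.
- apply regular_dt with l r; unfold time; auto; lra.
Qed.

(** The hypotheses are local because the derivative of a difference splits only where both functions
    are differentiable, and the induction needs this splitting on a whole neighbourhood. *)
Lemma ex_diff_n_minus (f g : R -> R -> R) (n : nat) (x y : R) :
  locally_2d (ex_diff_n f n) x y -> locally_2d (ex_diff_n g n) x y ->
  ex_diff_n (fun u v => f u v - g u v) n x y.
Proof.
revert f g x y; induction n as [|n IH]; intros f g x y Hf Hg.
- generalize (locally_2d_singleton _ _ _ Hf) (locally_2d_singleton _ _ _ Hg).
  intros [Cf _] [Cg _]; split; [now apply continuity_2d_pt_minus|trivial].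
- generalize (locally_2d_singleton _ _ _ Hf) (locally_2d_singleton _ _ _ Hg).
  intros [Cf [Xf [Yf _]]] [Cg [Xg [Yg _]]].
  assert (HD := locally_2d_and _ _ _ _ Hf Hg).
  split; [now apply continuity_2d_pt_minus|]; repeat split.
  + now apply (ex_derive_minus (V := R_NormedModule)).
  + now apply (ex_derive_minus (V := R_NormedModule)).
  + apply ex_diff_n_ext_loc with
      (fun u v => Derive (fun z => f z v) u - Derive (fun z => g z v) u).
    * revert HD; apply locally_2d_impl, locally_2d_forall.
      intros u v [[_ [H1 _]] [_ [H2 _]]]; symmetry; now apply Derive_minus.
    * apply IH.
      -- revert Hf; apply locally_2d_impl, locally_2d_forall.
         now intros u v [_ [_ [_ [H _]]]].
      -- revert Hg; apply locally_2d_impl, locally_2d_forall.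
         now intros u v [_ [_ [_ [H _]]]].
  + apply ex_diff_n_ext_loc with
      (fun u v => Derive (fun z => f u z) v - Derive (fun z => g u z) v).
    * revert HD; apply locally_2d_impl, locally_2d_forall.
      intros u v [[_ [_ [H1 _]]] [_ [_ [H2 _]]]]; symmetry; now apply Derive_minus.
    * apply IH.
      -- revert Hf; apply locally_2d_impl, locally_2d_forall.
         now intros u v [_ [_ [_ [_ H]]]].
      -- revert Hg; apply locally_2d_impl, locally_2d_forall.
         now intros u v [_ [_ [_ [_ H]]]].
Qed.

Lemma regular_locally_C2 (l r T : R) (u : R -> R -> R) (x t : R) :
  regular l r T u -> l < x < r -> 0 < t < T -> locally_2d (ex_diff_n u 2) x t.
Proof.
intros Hu Hx Ht.
generalize (locally_2d_open_rectangle l r 0 T x t Hx Ht).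
apply locally_2d_impl, locally_2d_forall.
intros y s [Hy Hs]; now apply (regular_C2 _ _ _ _ Hu).
Qed.

Lemma dx_minus (l r T : R) (u v : R -> R -> R) (x t : R) :
  regular l r T u -> regular l r T v -> l < r -> space l r x -> time T t ->
  dx l r (fun y s => u y s - v y s) x t = dx l r u x t - dx l r v x t.
Proof.
intros Hu Hv Hlr Hx Ht; apply Derive_within_eq.
- now apply space_proper.
- now apply (is_derive_within_minus _ (fun y => u y t) (fun y => v y t)); apply regular_dx with T.
Qed.

Lemma dt_minus (l r T : R) (u v : R -> R -> R) (x t : R) :
  regular l r T u -> regular l r T v -> space l r x -> time T t ->
  dt T (fun y s => u y s - v y s) x t = dt T u x t - dt T v x t.
Proof.
intros Hu Hv Hx Ht; apply Derive_within_eq.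
- now apply time_proper.
- now apply (is_derive_within_minus _ (fun s => u x s) (fun s => v x s)); apply regular_dt with l r.
Qed.

Lemma regular_minus (l r T : R) (u v : R -> R -> R) :
  l < r -> regular l r T u -> regular l r T v ->
  regular l r T (fun x t => u x t - v x t).
Proof.
intros Hlr Hu Hv; constructor.
- intros x t Hx Ht; apply ex_diff_n_minus; now apply regular_locally_C2 with l r T.
- intros x t Hx Ht; eexists; apply (is_derive_within_minus _ (fun y => u y t) (fun y => v y t));
    now apply regular_dx with T.
- intros x t Hx Ht; eexists; apply (is_derive_within_minus _ (fun s => u x s) (fun s => v x s));
    now apply regular_dt with l r.
- apply continuous_on_minus; [apply Hu|apply Hv].
- apply continuous_on_ext with (fun p => dx l r u (fst p) (snd p) - dx l r v (fst p) (snd p)).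
  + intros [x t] [Hx Ht]; symmetry; now apply dx_minus with T.
  + apply continuous_on_minus; [apply Hu|apply Hv].
- apply continuous_on_ext with (fun p => dt T u (fst p) (snd p) - dt T v (fst p) (snd p)).
  + intros [x t] [Hx Ht]; symmetry; now apply dt_minus with l r.
  + apply continuous_on_minus; [apply Hu|apply Hv].
Qed.

Lemma ex_diff_n_2_Derive (u : R -> R -> R) (x t : R) :
  locally_2d (ex_diff_n u 2) x t ->
  (locally x (fun y => ex_derive (fun z => u z t) y) /\
   ex_derive (fun y => Derive (fun z => u z t) y) x) /\
  (locally t (fun s => ex_derive (fun z => u x z) s) /\
   ex_derive (fun s => Derive (fun z => u x z) s) t).
Proof.
intros H.
generalize (locally_2d_singleton _ _ _ H); intros [_ [_ [_ [[_ [H1 _]] [_ [_ [H2 _]]]]]]].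
repeat split.
- generalize (locally_2d_1d_const_y _ _ _ H); apply filter_imp; now intros y [_ [H3 _]].
- exact H1.
- generalize (locally_2d_1d_const_x _ _ _ H); apply filter_imp; now intros y [_ [_ [H3 _]]].
- exact H2.
Qed.

Lemma wave_ivp_minus (c l r T : R) (f : R -> R -> R) (u0 v0 : R -> R) (u v : R -> R -> R) :
  l < r -> 0 < T -> wave_ivp c l r T f u0 v0 u -> wave_ivp c l r T f u0 v0 v ->
  wave_ivp c l r T (fun _ _ => 0) (fun _ => 0) (fun _ => 0) (fun x t => u x t - v x t).
Proof.
intros Hlr HT Hu Hv.
assert (Ru := wave_regular _ _ _ _ _ _ _ _ Hu).
assert (Rv := wave_regular _ _ _ _ _ _ _ _ Hv).
constructor.
- now apply regular_minus.
- intros x t Hx Ht.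
  destruct (ex_diff_n_2_Derive u x t) as [[u1 u2] [u3 u4]];
    [now apply regular_locally_C2 with l r T|].
  destruct (ex_diff_n_2_Derive v x t) as [[v1 v2] [v3 v4]];
    [now apply regular_locally_C2 with l r T|].
  assert (Eu := wave_pde _ _ _ _ _ _ _ _ Hu x t Hx Ht).
  assert (Ev := wave_pde _ _ _ _ _ _ _ _ Hv x t Hx Ht).
  cbn [Derive_n] in *.
  rewrite (Derive_ext_loc (fun s => Derive (fun z => u x z - v x z) s)
    (fun s => Derive (fun z => u x z) s - Derive (fun z => v x z) s)).
  2:{ generalize (filter_and _ _ u3 v3); apply filter_imp; intros s [H1 H2].
      now apply Derive_minus. }
  rewrite (Derive_ext_loc (fun y => Derive (fun z => u z t - v z t) y)
    (fun y => Derive (fun z => u z t) y - Derive (fun z => v z t) y)).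
  2:{ generalize (filter_and _ _ u1 v1); apply filter_imp; intros s [H1 H2].
      now apply Derive_minus. }
  rewrite !Derive_minus by assumption.
  change (Derive (Derive (fun z => u x z)) t
    - c ^ 2 * Derive (Derive (fun z => u z t)) x = f x t) in Eu.
  change (Derive (Derive (fun z => v x z)) t
    - c ^ 2 * Derive (Derive (fun z => v z t)) x = f x t) in Ev.
  lra.
- intros x Hx; rewrite (wave_init_value _ _ _ _ _ _ _ _ Hu x Hx),
    (wave_init_value _ _ _ _ _ _ _ _ Hv x Hx); ring.
- intros x Hx; rewrite (dt_minus l r T u v); auto; [|unfold space; lra|unfold time; lra].
  rewrite (wave_init_velocity _ _ _ _ _ _ _ _ Hu x Hx),
    (wave_init_velocity _ _ _ _ _ _ _ _ Hv x Hx); ring.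
Qed.

(** At an end of the smaller interval that is interior to the larger one, a two-sided limit is
    merely restricted to one side; uniqueness of the relative derivative identifies the two. *)
Lemma dx_restrict (l r l' r' T : R) (u : R -> R -> R) (x t : R) :
  regular l r T u -> l <= l' -> l' < r' -> r' <= r -> space l' r' x -> time T t ->
  dx l' r' u x t = dx l r u x t.
Proof.
unfold space; intros Hu H1 H2 H3 Hx Ht; apply Derive_within_eq.
- now apply space_proper.
- apply is_derive_within_subset with (space l r).
  + unfold space; intros; lra.
  + apply regular_dx with T; unfold space; auto; lra.
Qed.

Lemma regular_restrict (l r l' r' T : R) (u : R -> R -> R) :
  l <= l' -> l' < r' -> r' <= r -> regular l r T u -> regular l' r' T u.
Proof.
intros H1 H2 H3 Hu.
assert (HS : forall x, space l' r' x -> space l r x) by (unfold space; intros; lra).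
assert (HC : forall p, cylinder l' r' T p -> cylinder l r T p)
  by (intros p [Hx Ht]; split; auto).
constructor.
- intros x t Hx Ht; apply (regular_C2 _ _ _ _ Hu); auto; lra.
- intros x t Hx Ht; exists (dx l r u x t); apply is_derive_within_subset with (space l r); auto.
  apply regular_dx with T; auto; lra.
- intros x t Hx Ht; apply (regular_ex_dt _ _ _ _ Hu); auto.
- apply continuous_on_subset with (1 := HC), Hu.
- apply continuous_on_ext with (fun p => dx l r u (fst p) (snd p)).
  + intros [x t] [Hx Ht]; symmetry; now apply dx_restrict with T.
  + apply continuous_on_subset with (1 := HC), Hu.
- apply continuous_on_subset with (1 := HC), Hu.
Qed.

Lemma wave_ivp_restrict (c l r l' r' T : R) (f : R -> R -> R) (u0 v0 : R -> R) (u : R -> R -> R) :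
  l <= l' -> l' < r' -> r' <= r ->
  wave_ivp c l r T f u0 v0 u -> wave_ivp c l' r' T f u0 v0 u.
Proof.
intros H1 H2 H3 Hu; constructor.
- apply regular_restrict with l r; auto; apply Hu.
- intros x t Hx Ht; apply (wave_pde _ _ _ _ _ _ _ _ Hu); lra.
- intros x Hx; apply (wave_init_value _ _ _ _ _ _ _ _ Hu); lra.
- intros x Hx; apply (wave_init_velocity _ _ _ _ _ _ _ _ Hu); lra.
Qed.

(** * Riemann variables and characteristics *)

(** Only [c ^ 2] enters the equation. Hence each fact about [u_t - c u_x] also serves for
    [u_t + c u_x], and the right subdomain can be treated like the left one. *)
Lemma wave_ivp_opp_speed (c l r T : R) (f : R -> R -> R) (u0 v0 : R -> R) (u : R -> R -> R) :
  wave_ivp c l r T f u0 v0 u -> wave_ivp (- c) l r T f u0 v0 u.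
Proof.
intros Hu; constructor; try apply Hu.
intros x t Hx Ht; replace ((- c) ^ 2) with (c ^ 2) by ring; now apply Hu.
Qed.

(** The partial derivative in the first variable exists nearby and is continuous, the one in the
    second exists at the point: enough for a total differential, which the chain rule along
    characteristics requires. *)
Lemma differentiable_pt_lim_C1 (f : R -> R -> R) (x y : R) :
  locally_2d (ex_diff_n f 1) x y ->
  differentiable_pt_lim f x y (Derive (fun z => f z y) x) (Derive (fun z => f x z) y).
Proof.
intros H.
generalize (locally_2d_singleton _ _ _ H); intros [_ [_ [Hy [[Hc _] _]]]].
apply filterdiff_differentiable_pt_lim.
refine (is_derive_filterdiff f x y (fun u v => Derive (fun z => f z v) u) _ _ _ _).
- apply locally_2d_locally in H; revert H; apply filter_imp.
  intros [u v] [_ [H _]]; now apply Derive_correct.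
- now apply Derive_correct.
- now apply continuity_2d_pt_filterlim in Hc.
Qed.

(** The Riemann variable carried along [dx/dt = c]; [riemann (- c)] is the one carried the other
    way. One-sided derivatives define it up to the lateral boundary and the initial time. *)
Definition riemann (c l r T : R) (u : R -> R -> R) (x t : R) : R :=
  dt T u x t - c * dx l r u x t.

(* [d/ds (u_t - c u_x)(x + c s, t + s) = u_tt - c^2 u_xx], since the mixed
   derivatives cancel. *)
Lemma is_derive_riemann (c l r T : R) (f : R -> R -> R) (u0 v0 : R -> R) (u : R -> R -> R)
  (x t s : R) :
  wave_ivp c l r T f u0 v0 u -> l < x + c * s < r -> 0 < t + s < T ->
  is_derive (fun s => riemann c l r T u (x + c * s) (t + s)) s (f (x + c * s) (t + s)).
Proof.
intros Hu Hx Ht.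
assert (Ru := wave_regular _ _ _ _ _ _ _ _ Hu).
assert (Hpde := wave_pde _ _ _ _ _ _ _ _ Hu _ _ Hx Ht).
assert (HL := regular_locally_C2 l r T u _ _ Ru Hx Ht).
assert (Dx := differentiable_pt_lim_C1 (fun y s => Derive (fun z => u z s) y)
  (x + c * s) (t + s)).
assert (Dt := differentiable_pt_lim_C1 (fun y s => Derive (fun z => u y z) s)
  (x + c * s) (t + s)).
assert (HS := Schwarz u (x + c * s) (t + s)).
generalize (locally_2d_singleton _ _ _ HL).
intros [_ [_ [_ [[_ [_ [_ [_ [Cxt _]]]]] [_ [_ [_ [[Ctx _] _]]]]]]]].
assert (E : Derive (fun z => Derive (fun t0 => u z t0) (t + s)) (x + c * s) =
  Derive (fun z => Derive (fun t0 => u t0 z) (x + c * s)) (t + s)).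
{ apply HS; auto.
  revert HL; apply locally_2d_impl, locally_2d_forall.
  now intros y w [_ [H1 [H2 [[_ [_ [H3 _]]] [_ [H4 _]]]]]]. }
clear HS.
assert (D1 : is_derive (fun s => Derive (fun z => u (x + c * s) z) (t + s)
    - c * Derive (fun z => u z (t + s)) (x + c * s)) s (f (x + c * s) (t + s))).
{ rewrite <- Hpde; cbn [Derive_n].
  assert (A1 : derivable_pt_lim (fun s => x + c * s) s c)
    by (apply is_derive_Reals; auto_derive; [trivial|ring]).
  assert (A2 : derivable_pt_lim (fun s => t + s) s 1)
    by (apply is_derive_Reals; auto_derive; [trivial|ring]).
  assert (B1 := derivable_pt_lim_comp_2d _ _ _ _ _ _ _ _
    (Dt ltac:(revert HL; apply locally_2d_impl, locally_2d_forall;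
      now intros y w [_ [_ [_ [_ H]]]])) A1 A2).
  assert (B2 := derivable_pt_lim_comp_2d _ _ _ _ _ _ _ _
    (Dx ltac:(revert HL; apply locally_2d_impl, locally_2d_forall;
      now intros y w [_ [_ [_ [H _]]]])) A1 A2).
  apply is_derive_Reals in B1; apply is_derive_Reals in B2.
  cbv beta in B1, B2.
  evar_last.
  - eapply (is_derive_minus (V := R_NormedModule)); [exact B1|].
    apply is_derive_scal; exact B2.
  - unfold minus, plus, opp; simpl; rewrite <- E; ring. }
revert D1; apply is_derive_ext_loc.
(* [dt] and [dx] are known to agree with [Derive] inside the open rectangle, so the point on the
   characteristic has to stay inside for [s'] near [s]. *)
assert (HN : locally s (fun s' => (l < x + c * s' < r) /\ (0 < t + s' < T))).
{ assert (H := locally_2d_open_rectangle l r 0 T _ _ Hx Ht).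
  apply locally_2d_locally in H.
  assert (K : continuous (fun s' => (x + c * s', t + s')) s).
  { apply (continuous_comp_2 (fun s' => x + c * s') (fun s' => t + s') (fun a b => (a, b))).
    - apply (ex_derive_continuous (fun s' => x + c * s')); auto_derive; trivial.
    - apply (ex_derive_continuous (fun s' => t + s')); auto_derive; trivial.
    - apply continuous_ext with (fun p => p); [now intros []|apply continuous_id]. }
  exact (K _ H). }
revert HN; apply filter_imp; intros s' [Hx' Ht']; unfold riemann.
assert (Hx'' : space l r (x + c * s')) by (unfold space; lra).
assert (Ht'' : time T (t + s')) by (unfold time; lra).
f_equal; [|f_equal]; apply is_derive_unique.
- now apply is_derive_dt with l r.
- now apply is_derive_dx with T.
Qed.

Lemma continuous_on_riemann (c l r T : R) (u : R -> R -> R) :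
  regular l r T u -> continuous_on (cylinder l r T) (fun p => riemann c l r T u (fst p) (snd p)).
Proof.
intros Hu; apply continuous_on_minus; [|apply continuous_on_scal]; apply Hu.
Qed.

Lemma continuous_on_cylinder_line (F : R -> R -> R) (l r T x t p q a b : R) :
  continuous_on (cylinder l r T) (fun z => F (fst z) (snd z)) ->
  (forall s, a <= s <= b -> cylinder l r T (x + p * s, t + q * s)) ->
  continuous_on (fun s => a <= s <= b) (fun s => F (x + p * s) (t + q * s)).
Proof.
intros HF Hs.
apply (continuous_on_comp _ (cylinder l r T) (fun s => (x + p * s, t + q * s))
  (fun z => F (fst z) (snd z))); auto.
apply continuous_on_forall; intros s _.
apply (continuous_comp_2 (fun s' => x + p * s') (fun s' => t + q * s') (fun a b => (a, b))).
- apply (ex_derive_continuous (fun s' => x + p * s')); auto_derive; trivial.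
- apply (ex_derive_continuous (fun s' => t + q * s')); auto_derive; trivial.
- apply continuous_ext with (fun p => p); [now intros []|apply continuous_id].
Qed.

Local Notation zero_data := (fun _ : R => 0).
Local Notation zero_source := (fun _ _ : R => 0).

(** The derivative along the characteristic is the source, here zero. The ends of the segment may
    lie on the boundary and are reached by continuity. *)
Lemma riemann_transport (c l r T : R) (u0 v0 : R -> R) (e : R -> R -> R) (x t s : R) :
  wave_ivp c l r T zero_source u0 v0 e -> c <> 0 -> 0 <= s ->
  space l r x -> space l r (x + c * s) -> 0 <= t -> t + s < T ->
  riemann c l r T e (x + c * s) (t + s) = riemann c l r T e x t.
Proof.
intros He Hc Hs Hx Hxs Ht Hts; unfold space in *.
assert (Hin : forall y, 0 <= y <= s -> l <= x + c * y <= r).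
{ intros y Hy; destruct (Rlt_dec 0 c); split; nra. }
(* As [c] is nonzero, intermediate points are strictly inside even when both ends are on the
   boundary. *)
assert (Hin' : forall y, 0 < y < s -> l < x + c * y < r).
{ intros y Hy; destruct (Rlt_dec 0 c); split; nra. }
assert (H : riemann c l r T e (x + c * s) (t + 1 * s) =
  riemann c l r T e (x + c * 0) (t + 1 * 0)).
{ apply (is_derive_0_segment_const (fun y => riemann c l r T e (x + c * y) (t + 1 * y)) 0 s Hs).
  - apply continuous_on_cylinder_line with l r T.
    + apply continuous_on_riemann, He.
    + intros y Hy; split; unfold space, time; simpl; [auto|lra].
  - intros y Hy; apply is_derive_ext with (fun y => riemann c l r T e (x + c * y) (t + y)).
    + intros z; now rewrite Rmult_1_l.
    + apply (is_derive_riemann c l r T zero_source u0 v0); auto; lra. }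
now rewrite Rmult_1_l, !Rmult_0_r, !Rplus_0_r in H.
Qed.

(** [F] has derivative zero on the open interval, so it is constant on the closed one and takes its
    midpoint value at the ends. *)
Lemma continuous_on_zero_closure (F : R -> R) (l r x : R) :
  l < r -> continuous_on (fun y => l <= y <= r) F ->
  (forall y, l < y < r -> F y = 0) -> l <= x <= r -> F x = 0.
Proof.
intros Hlr HF H0 Hx.
assert (HD : forall y, l < y < r -> is_derive F y 0).
{ intros y Hy; apply is_derive_ext_loc with (fun _ => 0).
  - generalize (locally_open_interval l r y Hy); apply filter_imp; intros; symmetry; auto.
  - apply (is_derive_const (V := R_NormedModule)). }
set (m := (l + r) / 2).
assert (Hm : F m = 0) by (apply H0; unfold m; lra).
assert (H : forall a b, l <= a -> a <= b -> b <= r -> F b = F a).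
{ intros a b Ha Hab Hb; apply is_derive_0_segment_const; auto.
  - apply continuous_on_subset with (2 := HF); intros; lra.
  - intros; apply HD; lra. }
destruct (Rle_dec x m).
- rewrite <- (H x m); auto; unfold m in *; lra.
- rewrite (H m x); auto; unfold m in *; lra.
Qed.

(** The initial data are prescribed only for [l < x < r]; continuity carries the vanishing to the
    two corners, where a characteristic may start. *)
Lemma riemann_initial (c l r T : R) (e : R -> R -> R) (x : R) :
  wave_ivp c l r T zero_source zero_data zero_data e -> l < r -> 0 < T ->
  space l r x -> riemann c l r T e x 0 = 0.
Proof.
intros He Hlr HT.
assert (Re := wave_regular _ _ _ _ _ _ _ _ He).
apply (continuous_on_zero_closure (fun y => riemann c l r T e y 0)); auto.
- apply (continuous_on_comp _ (cylinder l r T) (fun y => (y, 0))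
    (fun z => riemann c l r T e (fst z) (snd z))).
  + intros y Hy; split; unfold space, time; simpl; lra.
  + apply continuous_on_forall; intros y _.
    apply (continuous_comp_2 (fun y => y) (fun _ => 0) (fun a b => (a, b))).
    * apply continuous_id.
    * apply continuous_const.
    * apply continuous_ext with (fun p => p); [now intros []|apply continuous_id].
  + now apply continuous_on_riemann.
- intros y Hy; unfold riemann.
  rewrite (wave_init_velocity _ _ _ _ _ _ _ _ He y Hy).
  assert (Ht : time T 0) by (unfold time; lra).
  assert (H : is_derive (fun z => e z 0) y 0); cycle 1.
  { apply is_derive_unique in H.
    rewrite <- (is_derive_unique _ _ _ (is_derive_dx l r T e y 0 Re Hy Ht)), H; ring. }
  apply is_derive_ext_loc with zero_data.
  + generalize (locally_open_interval l r y Hy); apply filter_imp; intros z Hz; symmetry.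
    now apply (wave_init_value _ _ _ _ _ _ _ _ He).
  + apply (is_derive_const (V := R_NormedModule)).
Qed.

(** * Delays and traces at the interface *)

(** Extension by zero to times [t <= 0]. It encodes the zero initial data, so that delayed traces
    can be written without case distinction. *)
Definition causal (F : R -> R) (t : R) : R := if Rlt_dec 0 t then F t else 0.

Lemma causal_neg (F : R -> R) (t : R) : t <= 0 -> causal F t = 0.
Proof. intros Ht; unfold causal; destruct (Rlt_dec 0 t); lra. Qed.

Lemma causal_pos (F : R -> R) (t : R) : 0 < t -> causal F t = F t.
Proof. intros Ht; unfold causal; destruct (Rlt_dec 0 t); lra. Qed.

(** The characteristic through the point either left [x] at the positive time [t - s], or started
    from the initial line, where the Riemann variable is zero. *)
Lemma riemann_delay (c l r T : R) (e : R -> R -> R) (x s t : R) :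
  wave_ivp c l r T zero_source zero_data zero_data e -> c <> 0 -> l < r ->
  space l r x -> space l r (x + c * s) -> 0 <= s -> time T t ->
  riemann c l r T e (x + c * s) t = causal (riemann c l r T e x) (t - s).
Proof.
unfold space, time; intros He Hc Hlr Hx Hxs Hs Ht.
destruct (Rlt_dec s t) as [H|H].
- rewrite causal_pos by lra.
  rewrite <- (riemann_transport c l r T zero_data zero_data e x (t - s) s);
    unfold space; auto; try lra.
  f_equal; ring.
- rewrite causal_neg by lra.
  (* Foot of the characteristic at time zero; as [t <= s], it lies between [x] and [x + c * s]. *)
  assert (Hy : l <= x + c * (s - t) <= r) by (destruct (Rlt_dec 0 c); split; nra).
  replace (x + c * s) with (x + c * (s - t) + c * t) by ring.
  replace t with (0 + t) at 3 by ring.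
  rewrite (riemann_transport c l r T zero_data zero_data); unfold space; auto; try lra.
  apply riemann_initial; auto; lra.
Qed.

Lemma dt_riemann (c l r T : R) (e : R -> R -> R) (x t : R) :
  dt T e x t = (riemann c l r T e x t + riemann (- c) l r T e x t) / 2.
Proof. unfold riemann; field. Qed.

Lemma dx_riemann (c l r T : R) (e : R -> R -> R) (x t : R) :
  c * dx l r e x t = (riemann (- c) l r T e x t - riemann c l r T e x t) / 2.
Proof. unfold riemann; field. Qed.

Lemma dt_eq_of_eq (l r l' r' T : R) (e e' : R -> R -> R) (x t : R) :
  regular l r T e -> regular l' r' T e' -> space l r x -> space l' r' x ->
  (forall t, 0 < t < T -> e x t = e' x t) -> 0 < t < T -> dt T e x t = dt T e' x t.
Proof.
intros He He' Hx Hx' Heq Ht.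
rewrite <- (is_derive_unique _ _ _ (is_derive_dt l r T e x t He Hx Ht)).
rewrite <- (is_derive_unique _ _ _ (is_derive_dt l' r' T e' x t He' Hx' Ht)).
apply Derive_ext_loc; generalize (locally_open_interval 0 T t Ht).
apply filter_imp; auto.
Qed.

Lemma dt_zero_of_zero (l r T : R) (e : R -> R -> R) (x t : R) :
  regular l r T e -> space l r x -> (forall t, 0 < t < T -> e x t = 0) ->
  0 < t < T -> dt T e x t = 0.
Proof.
intros He Hx H0 Ht.
rewrite <- (is_derive_unique _ _ _ (is_derive_dt l r T e x t He Hx Ht)).
transitivity (Derive zero_data t); [|apply Derive_const].
apply Derive_ext_loc; generalize (locally_open_interval 0 T t Ht).
apply filter_imp; auto.
Qed.

(* [x1] is the outer end of the subdomain and [x1 + c * tau] the interface, so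
   [c] is negative for the subdomain on the right.  [q] is half the Riemann
   variable entering at the interface; it comes back reflected, with a change
   of sign, after the round trip [2 * tau]. *)
Lemma interface_traces (c l r T : R) (e : R -> R -> R) (x1 tau : R) :
  wave_ivp c l r T zero_source zero_data zero_data e -> c <> 0 -> l < r -> 0 <= tau ->
  space l r x1 -> space l r (x1 + c * tau) ->
  (forall t, 0 < t < T -> e x1 t = 0) ->
  exists q : R -> R, (forall t, t <= 0 -> q t = 0) /\
    forall t, 0 < t < T ->
      dt T e (x1 + c * tau) t = q t - q (t - 2 * tau) /\
      c * dx l r e (x1 + c * tau) t = q t + q (t - 2 * tau) /\
      forall s, 0 <= s <= tau ->
        dt T e (x1 + c * s) t = q (t - (tau - s)) - q (t - (tau + s)).
Proof.
intros He Hc Hlr Htau Hx1 Hx0 H0.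
assert (He' := wave_ivp_opp_speed _ _ _ _ _ _ _ _ He).
set (x0 := x1 + c * tau) in *.
set (Q := causal (riemann (- c) l r T e x0)).
assert (Hseg : forall s, 0 <= s <= tau -> space l r (x1 + c * s)).
{ unfold space, x0 in *; intros s Hs; destruct (Rlt_dec 0 c); split; nra. }
(* The variable sent inward from the interface reaches [x1 + c * s] after the time [tau - s]. *)
assert (HQ : forall s t, 0 <= s <= tau -> 0 < t < T ->
  riemann (- c) l r T e (x1 + c * s) t = Q (t - (tau - s))).
{ intros s t Hs Ht; unfold Q.
  assert (E : x1 + c * s = x0 + - c * (tau - s)) by (unfold x0; ring).
  assert (H := Hseg s Hs); rewrite E in *.
  apply riemann_delay; auto; unfold time; lra. }
(* This variable is traced back to the outer end, where [e_t = 0] makes the two Riemann variables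
   opposite. The inward one needed [tau] to get there, and the reflected one needs [s] more. *)
assert (HP : forall s t, 0 <= s <= tau -> 0 < t < T ->
  riemann c l r T e (x1 + c * s) t = - Q (t - (tau + s))).
{ intros s t Hs Ht.
  rewrite riemann_delay; auto; [|lra|unfold time; lra].
  destruct (Rlt_dec s t) as [H|H].
  - rewrite causal_pos by lra.
    assert (H1 := dt_riemann c l r T e x1 (t - s)).
    rewrite (dt_zero_of_zero l r) in H1; auto; [|apply He|lra].
    assert (H2 := HQ 0 (t - s)).
    rewrite Rmult_0_r, Rplus_0_r in H2.
    rewrite H2 in H1 by lra.
    replace (t - (tau + s)) with (t - s - (tau - 0)) by ring; lra.
  - rewrite causal_neg by lra; unfold Q; rewrite causal_neg by lra; ring. }
assert (Hx0e : x0 = x1 + c * tau) by reflexivity.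
exists (fun t => Q t / 2); split.
- intros t Ht; unfold Q; rewrite causal_neg by lra; field.
- intros t Ht; rewrite Hx0e.
  rewrite (dx_riemann c l r T), (dt_riemann c l r), HQ, HP by lra.
  replace (t - (tau - tau)) with t by ring.
  replace (t - (tau + tau)) with (t - 2 * tau) by ring.
  repeat split; try field.
  intros s Hs; rewrite (dt_riemann c l r), HQ, HP by lra; field.
Qed.

(** * Delay equations and vanishing of the error *)

(** The equation determines [q] from its value one delay earlier, so vanishing spreads from [t <= 0]
    in steps of length [d]. Velocity traces lead to [k = - 1], normal derivative traces to
    [k = 1]. *)
Lemma delay_equation_zero (q h : R -> R) (k d s : R) :
  0 < d -> (forall t, t <= 0 -> q t = 0) ->
  (forall t, 0 < t < s -> q t + k * q (t - d) = 0) ->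
  forall t, t < s -> q t = 0.
Proof.
intros Hd H0 Hq.
assert (H : forall n t, t < INR n * d -> t < s -> q t = 0).
{ induction n as [|n IH]; intros t Htn Ht.
  - apply H0; simpl in Htn; lra.
  - destruct (Rle_dec t 0) as [H|H]; [now apply H0|].
    rewrite S_INR in Htn.
    assert (E := Hq t ltac:(lra)); rewrite (IH (t - d)) in E by lra; lra. }
intros t Ht.
destruct (INR_unbounded (t / d)) as [n Hn].
apply (H n); auto.
apply Rmult_lt_reg_r with (/ d); [now apply Rinv_0_lt_compat|].
replace (INR n * d * / d) with (INR n) by (field; lra); exact Hn.
Qed.

(** With zero velocity at the interface, [q] equals its own delay by the round trip, hence vanishes,
    and with it the velocity on the whole segment. *)
Lemma dt_zero_of_interface (c l r T : R) (e : R -> R -> R) (x1 tau : R) :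
  wave_ivp c l r T zero_source zero_data zero_data e -> c <> 0 -> l < r -> 0 < tau ->
  space l r x1 -> space l r (x1 + c * tau) ->
  (forall t, 0 < t < T -> e x1 t = 0) ->
  (forall t, 0 < t < T -> dt T e (x1 + c * tau) t = 0) ->
  forall s t, 0 <= s <= tau -> 0 < t < T -> dt T e (x1 + c * s) t = 0.
Proof.
intros He Hc Hlr Htau Hx1 Hx0 H1 H0 s t Hs Ht.
destruct (interface_traces c l r T e x1 tau) as [q [Hq0 Hq]]; auto; try lra.
assert (Hz : forall t, t < T -> q t = 0).
{ apply (delay_equation_zero q q (- 1) (2 * tau)); auto; [lra|].
  intros t' Ht'; destruct (Hq t' Ht') as [E _]; rewrite H0 in E; auto; lra. }
destruct (Hq t Ht) as [_ [_ E]]; rewrite E, !Hz by lra; ring.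
Qed.

Lemma wave_zero_of_dt_zero (c l r T : R) (e : R -> R -> R) (x t : R) :
  wave_ivp c l r T zero_source zero_data zero_data e -> l < x < r -> 0 < t < T ->
  (forall s, 0 < s < T -> dt T e x s = 0) -> e x t = 0.
Proof.
intros He Hx Ht H0.
assert (Re := wave_regular _ _ _ _ _ _ _ _ He).
rewrite <- (wave_init_value _ _ _ _ _ _ _ _ He x Hx).
apply (is_derive_0_segment_const (fun s => e x s)); [lra| |].
- apply continuous_on_ext with (fun s => e (x + 0 * s) (0 + 1 * s)).
  + intros s _; f_equal; ring.
  + apply continuous_on_cylinder_line with l r T; [apply Re|].
    intros s Hs; split; unfold space, time; simpl; lra.
- intros s Hs; rewrite <- (H0 s) by lra.
  apply is_derive_dt with l r; unfold space; auto; lra.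
Qed.

(* With [S_d] the delay by [d], the unknowns solve [h = (1 - S_alpha) q1] and
   so on.  Modulo products of two delays, [q1 = (1 + S_alpha) h],
   [q2 = (1 + S_beta) h], and the two corrections are
   [2 (1 + S_beta - S_alpha) h] and [2 (1 + S_alpha - S_beta) h]; their sum is
   [4 h], so that relaxation by [1 / 4] cancels [h] until the second delays. *)
Lemma delay_step (alpha beta T s : R) (h h' q1 q2 r1 r2 : R -> R) :
  0 < alpha -> 0 < beta ->
  (forall t, t <= 0 -> q1 t = 0) -> (forall t, t <= 0 -> q2 t = 0) ->
  (forall t, t <= 0 -> r1 t = 0) -> (forall t, t <= 0 -> r2 t = 0) ->
  (forall t, 0 < t < T -> h t = q1 t - q1 (t - alpha)) ->
  (forall t, 0 < t < T -> h t = q2 t - q2 (t - beta)) ->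
  (forall t, 0 < t < T ->
    r1 t + r1 (t - alpha) = q1 t + q1 (t - alpha) + (q2 t + q2 (t - beta))) ->
  (forall t, 0 < t < T ->
    r2 t + r2 (t - beta) = q1 t + q1 (t - alpha) + (q2 t + q2 (t - beta))) ->
  (forall t, 0 < t < T ->
    h' t = h t - 1 / 4 * (r1 t - r1 (t - alpha) + (r2 t - r2 (t - beta)))) ->
  (forall t, 0 < t < T -> t < s -> h t = 0) ->
  forall t, 0 < t < T -> t < s + 2 * Rmin alpha beta -> h' t = 0.
Proof.
intros Ha Hb Zq1 Zq2 Zr1 Zr2 E1 E2 F1 F2 G Hs t Ht Hts.
(* The identities hold before [T] and [h] vanishes before [s]; before [m] both are available. *)
set (m := Rmin s T).
assert (Hm : forall t, t < m -> t < s /\ t < T).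
{ intros u Hu; unfold m in Hu; generalize (Rmin_l s T) (Rmin_r s T); lra. }
assert (Hq1 : forall t, t < m -> q1 t = 0).
{ apply (delay_equation_zero q1 q1 (- 1) alpha); auto.
  intros u Hu; destruct (Hm u) as [H1 H2]; [lra|].
  assert (E := E1 u ltac:(lra)); rewrite Hs in E; lra. }
assert (Hq2 : forall t, t < m -> q2 t = 0).
{ apply (delay_equation_zero q2 q2 (- 1) beta); auto.
  intros u Hu; destruct (Hm u) as [H1 H2]; [lra|].
  assert (E := E2 u ltac:(lra)); rewrite Hs in E; lra. }
assert (Hr1 : forall t, t < m -> r1 t = 0).
{ apply (delay_equation_zero r1 r1 1 alpha); auto.
  intros u Hu; destruct (Hm u) as [H1 H2]; [lra|].
  assert (E := F1 u ltac:(lra)); rewrite !Hq1, !Hq2 in E; lra. }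
assert (Hr2 : forall t, t < m -> r2 t = 0).
{ apply (delay_equation_zero r2 r2 1 beta); auto.
  intros u Hu; destruct (Hm u) as [H1 H2]; [lra|].
  assert (E := F2 u ltac:(lra)); rewrite !Hq1, !Hq2 in E; lra. }
assert (Hmin := conj (Rmin_l alpha beta) (Rmin_r alpha beta)).
(* Two delays sum to at least [2 * Rmin alpha beta], which moves [t] below both [s] and [T], hence
   below [m]. *)
assert (Hpos : forall F : R -> R, forall d, (forall u, u <= 0 -> F u = 0) ->
  (forall u, u < m -> F u = 0) -> 2 * Rmin alpha beta <= d -> F (t - d) = 0).
{ intros F d HF0 HF Hd; destruct (Rlt_dec (t - d) m) as [H|H]; auto.
  exfalso; assert (Hpos := Rmin_pos alpha beta Ha Hb).
  apply H, Rmin_glb_lt; lra. }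
(* for [t <= d] both sides vanish *)
assert (I : forall d, 0 < d ->
  q1 (t - d) - q1 (t - d - alpha) = q2 (t - d) - q2 (t - d - beta) /\
  r1 (t - d) + r1 (t - d - alpha) =
    q1 (t - d) + q1 (t - d - alpha) + (q2 (t - d) + q2 (t - d - beta)) /\
  r2 (t - d) + r2 (t - d - beta) =
    q1 (t - d) + q1 (t - d - alpha) + (q2 (t - d) + q2 (t - d - beta))).
{ intros d Hd; destruct (Rlt_dec 0 (t - d)) as [H|H].
  - rewrite <- E1, <- E2, F1, F2 by lra; auto.
  - rewrite !Zq1, !Zq2, !Zr1, !Zr2 by lra; repeat split; ring. }
assert (Z : forall d d', Rmin alpha beta <= d -> Rmin alpha beta <= d' ->
  q1 (t - d - d') = 0 /\ q2 (t - d - d') = 0 /\ r1 (t - d - d') = 0 /\ r2 (t - d - d') = 0).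
{ intros d d' H1 H2; replace (t - d - d') with (t - (d + d')) by ring.
  repeat split; apply Hpos; auto; lra. }
(* The rest is linear. After one delay [q1] and [q2] agree, and [r1] and [r2] are twice their value,
   since all further delays vanish. Inserted at time [t], this makes the bracket in the update equal
   to [4 * h t]. *)
destruct (I alpha Ha) as [Ia1 [Ia2 Ia3]], (I beta Hb) as [Ib1 [Ib2 Ib3]].
destruct (Z alpha alpha) as [? [? [? ?]]]; try lra.
destruct (Z alpha beta) as [? [? [? ?]]]; try lra.
destruct (Z beta alpha) as [? [? [? ?]]]; try lra.
destruct (Z beta beta) as [? [? [? ?]]]; try lra.
assert (E1' := E1 t Ht); assert (E2' := E2 t Ht); assert (F1' := F1 t Ht);
  assert (F2' := F2 t Ht); rewrite (G t Ht); lra.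
Qed.

(** * Errors of one NNWR iteration at the interface *)

Section InterfaceError.

Variables (a b c T : R) (f g : R -> R -> R) (u0 v0 : R -> R) (u : R -> R -> R).
Hypotheses (hc : 0 < c) (ha : 0 < a) (hb : 0 < b) (hT : 0 < T).
Hypothesis Hu : model_solution c a b T f g u0 v0 u.

Let Wu : wave_ivp c (- a) b T f u0 v0 u := model_wave _ _ _ _ _ _ _ _ _ Hu.

Definition err (v : R -> R -> R) : R -> R -> R := fun x t => v x t - u x t.

Lemma err1_wave (v : R -> R -> R) :
  wave_ivp c (- a) 0 T f u0 v0 v ->
  wave_ivp c (- a) 0 T zero_source zero_data zero_data (err v).
Proof.
intros Hv; apply wave_ivp_minus with f u0 v0; auto; try lra.
apply wave_ivp_restrict with (- a) b; auto; lra.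
Qed.

Lemma err2_wave (v : R -> R -> R) :
  wave_ivp c 0 b T f u0 v0 v ->
  wave_ivp c 0 b T zero_source zero_data zero_data (err v).
Proof.
intros Hv; apply wave_ivp_minus with f u0 v0; auto; try lra.
apply wave_ivp_restrict with (- a) b; auto; lra.
Qed.

(* The exact solution is [C^1] across the interface, so it does not contribute
   to the jump of the normal derivatives. *)
Lemma err_jump (v1 v2 : R -> R -> R) (t : R) :
  wave_ivp c (- a) 0 T f u0 v0 v1 -> wave_ivp c 0 b T f u0 v0 v2 -> time T t ->
  dx (- a) 0 (err v1) 0 t - dx 0 b (err v2) 0 t = dn1 a v1 t + dn2 b v2 t.
Proof.
intros H1 H2 Ht; unfold err, dn1, dn2.
assert (Ru := wave_regular _ _ _ _ _ _ _ _ Wu).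
rewrite (dx_minus (- a) 0 T), (dx_minus 0 b T); auto; unfold space; try lra;
  try apply H1; try apply H2; try (apply regular_restrict with (- a) b; auto; lra).
rewrite (dx_restrict (- a) b (- a) 0 T u), (dx_restrict (- a) b 0 b T u);
  auto; unfold space; try lra.
Qed.

Lemma left_traces (e : R -> R -> R) :
  wave_ivp c (- a) 0 T zero_source zero_data zero_data e ->
  (forall t, 0 < t < T -> e (- a) t = 0) ->
  exists q : R -> R, (forall t, t <= 0 -> q t = 0) /\
    forall t, 0 < t < T ->
      dt T e 0 t = q t - q (t - 2 * (a / c)) /\
      c * dx (- a) 0 e 0 t = q t + q (t - 2 * (a / c)).
Proof.
intros He H0.
assert (Hac : 0 < a / c) by (apply Rdiv_lt_0_compat; lra).
assert (E : - a + c * (a / c) = 0) by (field; lra).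
destruct (interface_traces c (- a) 0 T e (- a) (a / c)) as [q [Hq0 Hq]];
  auto; unfold space; try lra.
rewrite E in Hq; exists q; split; auto.
intros t Ht; destruct (Hq t Ht) as [H1 [H2 _]]; auto.
Qed.

(** Here the interface lies to the left of the outer end, so the traces are taken with speed [- c];
    the sign is that of the outward normal derivative. *)
Lemma right_traces (e : R -> R -> R) :
  wave_ivp c 0 b T zero_source zero_data zero_data e ->
  (forall t, 0 < t < T -> e b t = 0) ->
  exists q : R -> R, (forall t, t <= 0 -> q t = 0) /\
    forall t, 0 < t < T ->
      dt T e 0 t = q t - q (t - 2 * (b / c)) /\
      - (c * dx 0 b e 0 t) = q t + q (t - 2 * (b / c)).
Proof.
intros He H0.
assert (Hbc : 0 < b / c) by (apply Rdiv_lt_0_compat; lra).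
assert (E : b + - c * (b / c) = 0) by (field; lra).
destruct (interface_traces (- c) 0 b T e b (b / c)) as [q [Hq0 Hq]];
  auto using wave_ivp_opp_speed; unfold space; try lra.
rewrite E in Hq; exists q; split; auto.
intros t Ht; destruct (Hq t Ht) as [H1 [H2 _]]; split; auto; lra.
Qed.

(** The Dirichlet solution [u1'] of the next iteration turns the guess [w'] into the trace of a
    regular function, which has a time derivative. The delays are the round trips [2 * (a / c)] and
    [2 * (b / c)], whence the factor 4. *)
Lemma NNWR_step_interface_error (w w' : R -> R) (u1 u2 psi1 psi2 u1' : R -> R -> R) (s : R) :
  NNWR_step c a b T (1 / 4) f g u0 v0 w u1 u2 psi1 psi2 w' ->
  wave_ivp c (- a) 0 T f u0 v0 u1' -> (forall t, 0 < t < T -> u1' 0 t = w' t) ->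
  (forall t, 0 < t < T -> t < s -> dt T (err u1) 0 t = 0) ->
  forall t, 0 < t < T -> t < s + 4 * Rmin (a / c) (b / c) -> dt T (err u1') 0 t = 0.
Proof.
intros HS W1' I1' Hs t Ht Hts.
destruct HS as [W1 O1 I1 W2 O2 I2 V1 P1 N1 V2 P2 N2 HW].
assert (X1 := err1_wave u1 W1); assert (X2 := err2_wave u2 W2).
assert (X1' := err1_wave u1' W1').
assert (Hac : 0 < a / c) by (apply Rdiv_lt_0_compat; lra).
assert (Hbc : 0 < b / c) by (apply Rdiv_lt_0_compat; lra).
assert (S1 : space (- a) 0 0) by (unfold space; lra).
assert (S2 : space 0 b 0) by (unfold space; lra).
destruct (left_traces (err u1) X1) as [q1 [Zq1 Hq1]].
{ intros y Hy; unfold err; rewrite O1, (model_left _ _ _ _ _ _ _ _ _ Hu); auto; ring. }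
destruct (right_traces (err u2) X2) as [q2 [Zq2 Hq2]].
{ intros y Hy; unfold err; rewrite O2, (model_right _ _ _ _ _ _ _ _ _ Hu); auto; ring. }
destruct (left_traces psi1 V1 P1) as [r1 [Zr1 Hr1]].
destruct (right_traces psi2 V2 P2) as [r2 [Zr2 Hr2]].
assert (Jump : forall y, 0 < y < T ->
  c * (dn1 a u1 y + dn2 b u2 y) =
  q1 y + q1 (y - 2 * (a / c)) + (q2 y + q2 (y - 2 * (b / c)))).
{ intros y Hy; rewrite <- err_jump; auto; [|unfold time; lra].
  destruct (Hq1 y Hy) as [_ K1], (Hq2 y Hy) as [_ K2]; lra. }
assert (D1 : forall y, 0 < y < T -> is_derive (fun z => err u1 0 z) y (dt T (err u1) 0 y))
  by (intros; apply is_derive_dt with (- a) 0; auto; apply X1).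
assert (D1' : forall y, 0 < y < T -> is_derive (fun z => err u1' 0 z) y (dt T (err u1') 0 y))
  by (intros; apply is_derive_dt with (- a) 0; auto; apply X1').
assert (E1 : forall y, 0 < y < T -> is_derive (fun z => psi1 0 z) y (dt T psi1 0 y))
  by (intros; apply is_derive_dt with (- a) 0; auto; apply V1).
assert (E2 : forall y, 0 < y < T -> is_derive (fun z => psi2 0 z) y (dt T psi2 0 y))
  by (intros; apply is_derive_dt with 0 b; auto; apply V2).
(* Both Dirichlet problems take the same guess [w], so [h] can be read off either error. *)
assert (D12 : forall y, 0 < y < T -> dt T (err u1) 0 y = dt T (err u2) 0 y).
{ intros y Hy; apply (dt_eq_of_eq (- a) 0 0 b); auto; [apply X1|apply X2|].
  intros z Hz; unfold err; rewrite I1, I2; auto. }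
apply (delay_step (2 * (a / c)) (2 * (b / c)) T s (dt T (err u1) 0) (dt T (err u1') 0)
  q1 q2 r1 r2); auto; try lra.
- intros y Hy; apply (Hq1 y Hy).
- intros y Hy; rewrite D12 by auto; apply (Hq2 y Hy).
- intros y Hy; rewrite <- Jump, <- N1 by auto; symmetry; apply (Hr1 y Hy).
- intros y Hy; rewrite <- Jump, <- N2 by auto; symmetry.
  destruct (Hr2 y Hy) as [_ <-]; unfold dn2; ring.
- intros y Hy.
  destruct (Hr1 y Hy) as [<- _], (Hr2 y Hy) as [<- _].
  (* The update is differentiated in time; the exact trace [u 0 z] is common to the old and the new
     error. *)
  assert (H : is_derive (fun z => err u1 0 z - 1 / 4 * (psi1 0 z + psi2 0 z)) y
    (dt T (err u1) 0 y - 1 / 4 * (dt T psi1 0 y + dt T psi2 0 y))).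
  { apply (is_derive_minus (V := R_NormedModule)); auto.
    apply is_derive_scal, (is_derive_plus (V := R_NormedModule)); auto. }
  rewrite <- (is_derive_unique _ _ _ (D1' y Hy)), <- (is_derive_unique _ _ _ H).
  apply Derive_ext_loc; generalize (locally_open_interval 0 T y Hy).
  apply filter_imp; intros z Hz; unfold err; rewrite I1', HW, I1; auto; ring.
- replace (2 * Rmin (2 * (a / c)) (2 * (b / c))) with (4 * Rmin (a / c) (b / c)); auto.
  unfold Rmin; repeat destruct Rle_dec; lra.
Qed.

End InterfaceError.

(** * Convergence of the iteration *)

Theorem theorem3 (a b c T : R) (f g : R -> R -> R) (u0 v0 : R -> R) (k : nat)
  (hc : 0 < c) (ha : 0 < a) (hb : 0 < b) (hab : a <> b)
  (hk : (1 <= k)%nat) (hT : 0 < T)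
  (hTk : T / INR k <= 4 * Rmin (a / c) (b / c)) :
  NNWR_converges_in_at_most c a b T (1 / 4) f g u0 v0 (k + 1).
Proof.
intros u Hu w u1 u2 psi1 psi2 Hrun.
assert (W : forall j, wave_ivp c (- a) 0 T f u0 v0 (u1 (S j))) by (intros j; apply (Hrun j)).
assert (I : forall j t, 0 < t < T -> u1 (S j) 0 t = w j t) by (intros j; apply (Hrun j)).
(* The index is shifted: [u1 (S j)] takes the guess [w j], which has been corrected [j] times. For
   [j = 0] no time [t] qualifies; each correction then extends the interval of vanishing. *)
assert (Hj : forall j t, 0 < t < T -> t < INR j * (4 * Rmin (a / c) (b / c)) ->
  dt T (err u (u1 (S j))) 0 t = 0).
{ induction j as [|j IH].
  - simpl; intros; lra.
  - intros t Ht Htj; rewrite S_INR in Htj.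
    apply (NNWR_step_interface_error a b c T f g u0 v0 u hc ha hb hT Hu _ _ _ _ _ _ (u1 (S (S j)))
      _ (Hrun j) (W (S j)) (I (S j)) IH); auto; lra. }
assert (Hk0 : 0 < INR k) by (apply lt_0_INR; lia).
assert (HTk : T <= INR k * (4 * Rmin (a / c) (b / c))).
{ replace T with (INR k * (T / INR k)) by (field; lra).
  apply Rmult_le_compat_l; lra. }
assert (Hac : 0 < a / c) by (apply Rdiv_lt_0_compat; lra).
assert (Hbc : 0 < b / c) by (apply Rdiv_lt_0_compat; lra).
replace (k + 1)%nat with (S k) by lia.
destruct (Hrun k) as [W1 O1 I1 W2 O2 I2 _ _ _ _ _ _ _].
assert (X1 := err1_wave a b c T f g u0 v0 u ha hb hT Hu _ W1).
assert (X2 := err2_wave a b c T f g u0 v0 u ha hb hT Hu _ W2).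
assert (Z1 : forall t, 0 < t < T -> dt T (err u (u1 (S k))) 0 t = 0)
  by (intros; apply Hj; lra).
assert (Z2 : forall t, 0 < t < T -> dt T (err u (u2 (S k))) 0 t = 0).
{ intros t Ht; transitivity (dt T (err u (u1 (S k))) 0 t); auto.
  apply (dt_eq_of_eq 0 b (- a) 0); auto;
    [apply X2|apply X1|unfold space; lra|unfold space; lra|].
  intros s Hs; unfold err; rewrite I1, I2; auto. }
split; intros x t Hx Ht; apply Rminus_diag_uniq.
- apply (wave_zero_of_dt_zero c (- a) 0 T (err u (u1 (S k)))); auto.
  (* [(x + a) / c] is the travel time from the outer end [- a] to [x]. *)
  intros s Hs; replace x with (- a + c * ((x + a) / c)) by (field; lra).
  assert (Hac0 : - a + c * (a / c) = 0) by (field; lra).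
  apply (dt_zero_of_interface c (- a) 0 T _ (- a) (a / c)); rewrite ?Hac0;
    unfold space; auto; try lra.
  + intros y Hy; unfold err; rewrite O1, (model_left _ _ _ _ _ _ _ _ _ Hu); auto; ring.
  + split; [apply Rdiv_le_0_compat; lra|apply Rmult_le_compat_r; [|lra]].
    left; now apply Rinv_0_lt_compat.
- apply (wave_zero_of_dt_zero c 0 b T (err u (u2 (S k)))); auto.
  (* [(b - x) / c] is the travel time from the outer end [b] to [x], moving left. *)
  intros s Hs; replace x with (b + - c * ((b - x) / c)) by (field; lra).
  assert (Hbc0 : b + - c * (b / c) = 0) by (field; lra).
  apply (dt_zero_of_interface (- c) 0 b T _ b (b / c)); rewrite ?Hbc0;
    auto using wave_ivp_opp_speed; unfold space; try lra.
  + intros y Hy; unfold err; rewrite O2, (model_right _ _ _ _ _ _ _ _ _ Hu); auto; ring.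
  + split; [apply Rdiv_le_0_compat; lra|apply Rmult_le_compat_r; [|lra]].
    left; now apply Rinv_0_lt_compat.
Qed.
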